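(* Let $\tau\in\{123,321\}\subset S_3$. Let $n\ge3$, $l\in\{2,\dots,n-1\}$ and $k\in\mathbb{N}$ with $k\ge1$ and $k+l-1\le n$. Then $$P_n^{\mathrm{av}(\tau)}(A^{(n)}_{l;k})=\frac{C_{n-l+1}+C_{k-1}\,C_{n-k-l+1}\,(C_l-1)}{C_n},$$ where $C_j=\frac1{j+1}\binom{2j}{j}$, $j\ge0$, is the $j$th Catalan number.
   Context: $S_n$ is the set of permutations of $[n]=\{1,\dots,n\}$, written $\sigma=\sigma_1\sigma_2\cdots\sigma_n$. For $l\in\{2,\dots,n-1\}$ and $k\ge1$ with $k+l-1\le n$, $A^{(n)}_{l;k}\subset S_n$ is the set of $\sigma\in S_n$ for which there exists $a$ with $\{k,k+1,\dots,k+l-1\}=\{\sigma_a,\sigma_{a+1},\dots,\sigma_{a+l-1}\}$. For $\tau\in S_m$ with $2\le m\le n$, $\sigma\in S_n$ contains $\tau$ as a pattern if there are indices $1\le i_1<\cdots<i_m\le n$ such that for all $1\le j,j'\le m$, $\sigma_{i_j}<\sigma_{i_{j'}}$ if and only if $\tau_j<\tau_{j'}$; otherwise $\sigma$ avoids $\tau$. $S_n(\tau)$ is the set of $\sigma\in S_n$ avoiding $\tau$; if $n<m$, $S_n(\tau)=S_n$. $P_n^{\mathrm{av}(\tau)}$ is the uniform probability measure on $S_n(\tau)$, so $P_n^{\mathrm{av}(\tau)}(A)=|A\cap S_n(\tau)|/|S_n(\tau)|$ for $A\subset S_n$. *)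

(* Defs.v *)
From mathcomp Require Import all_boot all_order all_algebra all_fingroup.

Set Implicit Arguments.
Unset Strict Implicit.
Unset Printing Implicit Defensive.

Import GRing.Theory.

(* Permutations of [n] = {1, ..., n} are encoded as 'S_n, which acts on
   'I_n = {0, ..., n-1}: positions and values are both shifted down by one,
   i.e. sigma_{i+1} = (sigma i).+1 for i : 'I_n. *)

Definition one_line n (s : 'S_n) : seq nat := [seq (s i).+1 | i : 'I_n].

(* A_{l;k}^{(n)}: the values k, ..., k+l-1 (1-based) fill the l consecutive
   0-based positions a, ..., a+l-1. *)
Definition clustered (n l k : nat) : {set 'S_n} :=
  [set s : 'S_n | [exists a : 'I_n, (a + l <= n) &&
     ([set j : 'I_n | k <= j.+1 <= k + l - 1]
        == [set s i | i : 'I_n & a <= i < a + l])]].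

Definition contains_pattern m n (t : 'S_m) (s : 'S_n) : bool :=
  [exists f : {ffun 'I_m -> 'I_n},
     [forall j : 'I_m, forall j' : 'I_m, (j < j') ==> (f j < f j')] &&
     [forall j : 'I_m, forall j' : 'I_m,
        (s (f j) < s (f j')) == (t j < t j')]].

Definition avoiders m n (t : 'S_m) : {set 'S_n} :=
  [set s : 'S_n | ~~ contains_pattern t s].

Local Open Scope ring_scope.

Definition avoid_prob m n (t : 'S_m) (A : {set 'S_n}) : rat :=
  #|A :&: avoiders n t|%:R / #|avoiders n t|%:R.

Definition catalan (j : nat) : rat := (j.+1%:R)^-1 * 'C(2 * j, j)%:R.

(* Main.v *)
Require Import Defs.
From mathcomp Require Import all_boot all_order all_algebra all_fingroup zify.
Import GRing.Theory.

(* Reversing words exchanges 123 and 321 and keeps blocks, so take 321. Inserting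
   a new maximum into a 321-avoiding word is allowed exactly inside its increasing
   suffix; the length of that suffix drives the Catalan generating tree, which
   gives C_n avoiders. Now let the values k, ..., k+l-1 occupy consecutive
   positions. If they occur in increasing order, contracting the block to one
   point is a bijection onto the avoiders of size n-l+1. Otherwise the block has
   an inversion, so everything before it is smaller and everything after it is
   larger: the word is a direct sum of an avoider of size k-1, a non-identity
   avoider of size l and an avoider of size n-k-l+1. *)

(** * 321-avoiding words and insertion of a new maximum *)

(* Avoidance of the pattern 321: no entry [x] is followed by [y] and then by [z] with [z < y < x]. *)
Fixpoint av (w : seq nat) : bool :=
  if w is x :: s then pairwise (fun y z => ~~ (z < y < x)) s && av s else true.

(* Length of the longest increasing suffix of a duplicate-free word. *)
Fixpoint inc_suffix (w : seq nat) : nat :=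
  if w is x :: s then if pairwise leq w then size w else inc_suffix s else 0.

Lemma inc_suffix_le w : inc_suffix w <= size w.
Proof. by elim: w => //= x s IH; case: ifP => // _; lia. Qed.

Lemma pairwise_leq_drop w i : i <= size w ->
  pairwise leq (drop i w) = (size w - inc_suffix w <= i).
Proof.
elim: w i => [|x s IH] [|i] //= hi.
- by case: ifP => _; have := inc_suffix_le s; lia.
- have := inc_suffix_le s.
  case: ifP => [/andP[_ ps]|_] hs; rewrite IH; try lia.
  have := IH 0 isT; rewrite drop0 ps; lia.
Qed.

Lemma inc_suffix_sorted w : pairwise leq w -> inc_suffix w = size w.
Proof. by case: w => //= x s ->. Qed.

Lemma inc_suffix_rcons w n : all (fun x => x < n) w ->
  inc_suffix (w ++ [:: n]) = (inc_suffix w).+1.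
Proof.
elim: w => [//|x s IH] /= /andP[xn hs].
rewrite all_cat pairwise_cat /= allrel1r !andbT (ltnW xn) andbT IH // size_cat addn1.
have -> : all (leq^~ n) s by apply: sub_all hs => y /ltnW.
by case: ifP.
Qed.

(** As soon as something follows it, the maximum [n] starts a descent, so no increasing suffix
    reaches back to it. *)
Lemma inc_suffix_ins u t n : t != [::] -> all (fun x => x < n) t ->
  pairwise leq t -> inc_suffix (u ++ n :: t) = size t.
Proof.
move=> t0 hn ht.
have nt : pairwise leq (n :: t) = false.
  by case: t t0 hn {ht} => //= y t _ /andP[yn _]; rewrite leqNgt yn.
elim: u => [|x u IH]; first by rewrite /= -/(pairwise leq (n :: t)) nt inc_suffix_sorted.
rewrite [LHS]/= -/(pairwise leq (x :: (u ++ n :: t))) -cat_cons pairwise_cat nt !andbF.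
exact: IH.
Qed.

(* A new maximum [n] creates a 321 exactly when a descent follows it. *)
Lemma av_ins u t n : all (fun x => x < n) (u ++ t) ->
  av (u ++ n :: t) = av (u ++ t) && pairwise leq t.
Proof.
elim: u => [|x u IH] /=.
  move=> hn; rewrite andbC; congr andb.
  elim: t hn => //= y t IH /andP[yn hn]; rewrite IH //; congr andb.
  by apply: eq_in_all => z _ /=; rewrite yn andbT -leqNgt.
case/andP=> xn hn; rewrite IH // -andbA; congr andb.
move: hn; rewrite all_cat => /andP[hu ht].
rewrite !pairwise_cat allrel_consr /=.
have -> : all (fun y => ~~ (n < y < x)) u.
  by apply: sub_all hu => y yn; lia.
have -> : all (fun z => ~~ (z < n < x)) t by apply/allP=> z _; lia.
by [].
Qed.

(** * The generating tree of 321-avoiders and its level sizes *)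

(** By [av_ins], these are the positions where a 321-avoiding word of size [n] can receive the
    letter [n]. *)
Definition sites (n : nat) (w : seq nat) :=
  [seq i <- iota 0 n.+1 | pairwise leq (drop i w)].

Definition ins (n : nat) (w : seq nat) (i : nat) := take i w ++ n :: drop i w.

Fixpoint av_words n : seq (seq nat) :=
  if n is m.+1 then [seq ins m w i | w <- av_words m, i <- sites m w]
  else [:: [::]].

Lemma perm_iota_lt {n w} : perm_eq w (iota 0 n) -> all (fun x => x < n) w.
Proof. by move=> /perm_all ->; apply/allP => x; rewrite mem_iota. Qed.

Lemma perm_iota_size {n w} : perm_eq w (iota 0 n) -> size w = n.
Proof. by move=> /perm_size ->; rewrite size_iota. Qed.

Lemma perm_ins n w i : perm_eq (ins n w i) (n :: w).
Proof. by rewrite /ins -cat1s perm_catCA /= cat_take_drop. Qed.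

(** Deleting the maximum of an avoider leaves an avoider, and its former position is an allowed
    site. *)
Lemma mem_av_words n w : (w \in av_words n) = perm_eq w (iota 0 n) && av w.
Proof.
elim: n w => [|n IH] w.
  rewrite inE; apply/eqP/andP => [->//|[/perm_nilP ->//]].
apply/allpairsPdep/andP => [[v [i [hv hi ->]]]|[hp ha]].
  move: hv hi; rewrite IH mem_filter => /andP[pv av_v] /andP[hd hi].
  split.
    rewrite (perm_trans (perm_ins _ _ _)) // -addn1 iotaD /= perm_sym cats1 perm_rcons perm_cons.
    by rewrite perm_sym.
  by rewrite /ins av_ins ?cat_take_drop ?av_v // perm_iota_lt.
have hn : n \in w by rewrite (perm_mem hp) mem_iota; lia.
have uw : uniq w by rewrite (perm_uniq hp) iota_uniq.
case/splitPr: hn hp ha uw => u t hp ha uw.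
have pv : perm_eq (u ++ t) (iota 0 n).
  rewrite -(perm_cons n) perm_sym -perm_rcons -cats1 perm_sym.
  have -> : iota 0 n ++ [:: n] = iota 0 n.+1 by rewrite -addn1 iotaD.
  by rewrite -(permPr hp) -cat1s perm_catCA.
exists (u ++ t), (size u); rewrite IH pv mem_filter /ins take_size_cat // drop_size_cat //.
move: ha; rewrite av_ins ?perm_iota_lt // => /andP[-> ->].
by split=> //; rewrite mem_iota -(perm_iota_size pv) size_cat; lia.
Qed.

Lemma uniq_av_words n : uniq (av_words n).
Proof.
elim: n => //= n IH.
apply: allpairs_uniq_dep => // [w _|]; first exact: filter_uniq (iota_uniq _ _).
move=> [w i] [w' i'] /allpairsPdep[v [j [hv hj e1]]] /allpairsPdep[v' [j' [hv' hj' e2]]] /=.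
move: hv hj; rewrite mem_av_words mem_filter mem_iota => /andP[pv _] /andP[_ /andP[_ hj]].
move: hv' hj'; rewrite mem_av_words mem_filter mem_iota => /andP[pv' _] /andP[_ /andP[_ hj']].
case: e1 => -> ->; case: e2 => -> -> {w i w' i'} e.
have nin u : perm_eq u (iota 0 n) -> forall m, (n \in take m u) = false.
  move=> pu m; apply/negP => /mem_take; rewrite (perm_mem pu) mem_iota; lia.
(* The position of the letter [n] reveals the insertion site; the parent word is then what surrounds
   it. *)
have ej : j = j'.
  have := congr1 (index n) e.
  by rewrite /ins !index_cat !nin //= eqxx !addn0 !size_takel ?(perm_iota_size pv) ?(perm_iota_size pv').
rewrite -ej in e *.
move: e; rewrite /ins => /eqP.
rewrite eqseq_cat; last by rewrite !size_takel ?(perm_iota_size pv) ?(perm_iota_size pv').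
move=> /andP[/eqP et]; rewrite eqseq_cons => /andP[_ /eqP ed].
by rewrite -(cat_take_drop j v) et ed cat_take_drop.
Qed.

(* Inserting a new maximum into a word with increasing suffix of length [s]
   yields one word for each suffix length in {1, ..., s + 1}; this counts the
   words obtained after [m] insertions. *)
Fixpoint descendants m s : nat :=
  if m is p.+1 then \sum_(1 <= j < s.+2) descendants p j else 1.

Lemma sum_sites n w m : perm_eq w (iota 0 n) ->
  \sum_(i <- sites n w) descendants m (inc_suffix (ins n w i)) =
  descendants m.+1 (inc_suffix w).
Proof.
move=> pw; have sw := perm_iota_size pw; have hw := perm_iota_lt pw.
have hs := inc_suffix_le w; set s := inc_suffix w in hs *; rewrite sw in hs.
(* The first [s] sites lie before a nonempty increasing tail; the last one appends [n] and lengthens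
   the suffix to [s + 1]. *)
have -> : sites n w = iota (n - s) s ++ [:: n].
  rewrite /sites (@eq_in_filter _ _ (fun i => n - s <= i)); last first.
    by move=> i; rewrite mem_iota => hi; rewrite pairwise_leq_drop ?sw //; lia.
  have -> : n.+1 = (n - s) + s.+1 by lia.
  rewrite iotaD filter_cat add0n.
  rewrite (@eq_in_filter _ _ pred0) ?filter_pred0; last first.
    by move=> i; rewrite mem_iota /=; lia.
  rewrite (@eq_in_filter _ _ predT) ?filter_predT; last first.
    by move=> i; rewrite mem_iota /=; lia.
  by rewrite -addn1 iotaD /=; congr (_ ++ [:: _]); lia.
rewrite big_cat big_seq1 /= /ins take_oversize ?drop_oversize ?sw //.
rewrite inc_suffix_rcons // -/s big_nat_recr //=; congr addn.
(* From left to right these sites produce suffix lengths [s], ..., 1, hence the reversal. *)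
rewrite big_nat_rev /= -{1}[n - s]addn0 iotaDl big_map.
rewrite -[s in LHS]subn0 -/(index_iota 0 s) [RHS]big_add1 /=.
rewrite !big_nat; apply: eq_bigr => i /andP[_ hi]; congr descendants.
rewrite inc_suffix_ins.
- by rewrite size_drop sw; lia.
- by rewrite -size_eq0 size_drop sw; lia.
- by apply/allP => x /mem_drop; apply: (allP hw).
- by rewrite pairwise_leq_drop ?sw -/s; lia.
Qed.

Lemma size_av_words n : size (av_words n) = descendants n 0.
Proof.
(* Generalized to any level [p], so that the induction can trade one level of the tree for one
   unfolding of [descendants]. *)
suff H m p : \sum_(w <- av_words p) descendants m (inc_suffix w) = size (av_words (m + p)).
  by rewrite -[n in LHS]addn0 -H big_seq1.
elim: m p => [|m IH] p; first by rewrite sum1_size.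
rewrite addSnnS -IH big_allpairs_dep [RHS]big_seq big_seq; apply: eq_bigr => w.
by rewrite mem_av_words => /andP[pw _]; rewrite sum_sites.
Qed.

(* The ballot number 'C(2m+s, m) - 'C(2m+s, m-1), without subtraction. *)
Lemma descendantsE m s :
  descendants m s + (if m is p.+1 then 'C(2 * m + s, p) else 0) = 'C(2 * m + s, m).
Proof.
elim: m s => [|m IH] s; first by rewrite bin0.
(* Raising [s] adds one summand, evaluated by [IH]; Pascal's rule then absorbs it. *)
rewrite /=; elim: s => [|s IHs].
  rewrite big_nat1; have := IH 1.
  have -> : 2 * m.+1 + 0 = (2 * m + 1).+1 by lia.
  rewrite binS; have -> : 'C(2 * m + 1, m.+1) = 'C(2 * m + 1, m).
    by rewrite -bin_sub; [congr binomial; lia|lia].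
  by case: m {IH} => [|m]; rewrite ?bin0 ?binS; lia.
rewrite big_nat_recr //=; have := IH s.+2.
have -> : 2 * m.+1 + s.+1 = (2 * m.+1 + s).+1 by lia.
have -> : 2 * m + s.+2 = 2 * m.+1 + s by lia.
by rewrite binS; case: m {IH} IHs => [|m]; rewrite ?bin0 ?binS; lia.
Qed.

(** * Avoidance under shifts, direct sums and contraction of runs *)

Lemma mem_shift_av_words k l v :
  (v \in [seq map (addn k) u | u <- av_words l]) = perm_eq v (iota k l) && av v.
Proof.
have avD u : av (map (addn k) u) = av u.
  elim: u => //= x u ->; rewrite pairwise_map; congr andb.
  by apply: eq_pairwise => y z /=; rewrite !ltn_add2l.
have iotak : iota k l = map (addn k) (iota 0 l) by rewrite -iotaDl addn0.
apply/mapP/andP => [[u]|[pv av_v]].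
  rewrite mem_av_words => /andP[pu av_u] ->.
  by rewrite avD iotak perm_map.
(* The truncated subtraction is exact, because every entry of [v] is at least [k]. *)
have ev : v = map (addn k) (map (subn^~ k) v).
  rewrite -map_comp -[LHS]map_id; apply/eq_in_map => x.
  by rewrite (perm_mem pv) mem_iota /=; lia.
exists (map (subn^~ k) v) => //; rewrite mem_av_words -avD -ev av_v andbT.
rewrite (perm_trans (perm_map _ pv)) // iotak -map_comp.
by rewrite (@eq_map _ _ _ id) ?map_id // => x /=; lia.
Qed.

Lemma count_permutations n (P : pred (seq nat)) (L : seq (seq nat)) :
  uniq L -> (forall w, (w \in L) = perm_eq w (iota 0 n) && P w) ->
  count P (permutations (iota 0 n)) = size L.
Proof.
move=> uL hL; rewrite -size_filter; apply: perm_size; apply: uniq_perm => //.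
  by rewrite filter_uniq ?permutations_uniq.
by move=> w; rewrite mem_filter mem_permutations hL andbC.
Qed.

Lemma av_catr u v : av (u ++ v) -> av v.
Proof. by elim: u => //= x u IH /andP[_]. Qed.

Lemma av_catl u v : av (u ++ v) -> av u.
Proof.
by elim: u => //= x u IH /andP[]; rewrite pairwise_cat => /and3P[_ -> _] /IH.
Qed.

(** A 321 cannot straddle the two words, since no descent goes from [u] to [v]. *)
Lemma av_direct_sum u v : allrel ltn u v -> av (u ++ v) = av u && av v.
Proof.
elim: u => //= x u IH; rewrite allrel_consl => /andP[xv uv].
rewrite IH // andbA; congr (_ && _ && _).
rewrite pairwise_cat.
have -> : pairwise (fun y z => ~~ (z < y < x)) v.
  elim: v xv {IH uv} => //= y v IH /andP[xy xv]; rewrite IH // andbT.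
  by apply/allP => z _; lia.
rewrite andbT; suff -> : allrel (fun y z => ~~ (z < y < x)) u v by [].
apply/allrelP => y z hy hz; have := allP xv z hz; have := allrelP uv y z hy hz; lia.
Qed.

(** A 321 uses at most one entry of an increasing run, and each outside entry compares in the same
    way with all values of the block, so any [r] in the block can represent it. *)
Lemma av_collapse u t k l r : k <= r < k + l ->
  all (fun x => ~~ (k <= x < k + l)) (u ++ t) ->
  av (u ++ iota k l ++ t) = av (u ++ r :: t).
Proof.
move=> hr; elim: u => [|x u IH] /=.
  (* Peeling the run from the left leaves runs [iota p q] with the same right end; only a nonempty
     one constrains [t] through [r]. *)
  move=> ht; have H p q : k <= p -> p + q = k + l ->
    av (iota p q ++ t) = av t && ((q == 0) || pairwise (fun y z => ~~ (z < y < r)) t).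
    elim: q p => [|q IHq] p hp hpq /=; first by rewrite andbT.
    rewrite IHq; [|lia|lia].
    rewrite pairwise_cat.
    have -> : allrel (fun y z => ~~ (z < y < p)) (iota p.+1 q) t.
      by apply/allrelP => y z; rewrite mem_iota; lia.
    have -> : pairwise (fun y z => ~~ (z < y < p)) (iota p.+1 q).
      apply/(pairwiseP 0) => i j; rewrite !inE size_iota => hi hj ij.
      by rewrite !nth_iota //; lia.
    have -> : pairwise (fun y z => ~~ (z < y < p)) t =
              pairwise (fun y z => ~~ (z < y < r)) t.
      by apply: eq_in_pairwise ht => y z; rewrite !unfold_in; lia.
    by rewrite /=; case: pairwise; rewrite ?orbT ?andbF ?andbT.
  by rewrite H // andbC; case: (l =P 0) => //=; lia.
case/andP=> hx hut; rewrite IH //; congr andb.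
move: hut; rewrite all_cat => /andP[hu ht].
rewrite !pairwise_cat !allrel_catr !allrel_consr /=.
set R := (fun y z => ~~ (z < y < x)).
have -> : allrel R u (iota k l) = all (R^~ r) u.
  apply/allrelP/allP => [H y hy|H y z hy].
    by apply: H => //; rewrite mem_iota.
  rewrite mem_iota => hz; have := H y hy; rewrite /R; have := allP hu y hy; lia.
have -> : allrel R (iota k l) t = all (R r) t.
  apply/allrelP/allP => [H z hz|H y z].
    by apply: H => //; rewrite mem_iota.
  rewrite mem_iota => hy hz; have := H z hz; rewrite /R; have := allP ht z hz; lia.
have -> : pairwise R (iota k l).
  apply/(pairwiseP 0) => i j; rewrite !inE size_iota => hi hj ij.
  by rewrite /R !nth_iota //; lia.
by rewrite andbA.
Qed.

(* With [av_above_left]: an inversion in [v] forbids entries above [v] on its left and below [v] on its right. *)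
Lemma av_below_right v q y : av (v ++ q) -> y \in q -> all (ltn y) v -> pairwise leq v.
Proof.
move=> + yq; elim: v => //= x v IH /andP[hx hv] /andP[yx yv].
rewrite IH // andbT; apply/allP => z zv.
move: hx; rewrite pairwise_cat => /and3P[/allrelP/(_ z y zv yq) + _ _].
have := allP yv z zv; rewrite /=; lia.
Qed.

Lemma av_above_left p v x : av (p ++ v) -> x \in p -> all (gtn x) v -> pairwise leq v.
Proof.
elim: p => //= y p IH /andP[hy hp]; rewrite inE => /orP[/eqP->|]; last exact: IH.
move: hy; rewrite pairwise_cat => /and3P[_ _ hv] hx.

move: hv; congr is_true; apply: eq_in_pairwise hx => a b; rewrite !unfold_in /=; lia.
Qed.

Lemma av_iota a b : av (iota a b).
Proof.
elim: b a => //= b IH a; rewrite IH andbT.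
by apply/(pairwiseP 0) => i j; rewrite !inE size_iota => hi hj ij; rewrite !nth_iota //; lia.
Qed.

(** * Words whose block values are contiguous, counted by the order inside the block *)

Section Block.

Variables k l : nat.
(** Values are 0-based, so this [k] is one less than that of the theorem. *)
Definition in_block x := k <= x < k + l.

Lemma filter_in_block_perm n w : k + l <= n -> perm_eq w (iota 0 n) ->
  perm_eq (filter in_block w) (iota k l).
Proof.
move=> hn pw; apply: uniq_perm; rewrite ?iota_uniq //.
  by rewrite filter_uniq // (perm_uniq pw) iota_uniq.
move=> x; rewrite mem_filter (perm_mem pw) !mem_iota /in_block; lia.
Qed.

Lemma filter_in_block_cat p v q : all in_block v ->
  all (predC in_block) (p ++ q) -> filter in_block (p ++ v ++ q) = v.
Proof.
move=> /all_filterP hv; rewrite all_cat => /andP[hp hq].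
have f0 s : all (predC in_block) s -> filter in_block s = [::].
  by move=> hs; apply/eqP; rewrite -(negbK (_ == _)) -has_filter -all_predC.
by rewrite !filter_cat hv !f0 // cats0.
Qed.

(** The factor already carries all block entries of [w]; comparing sizes leaves none for [p] and
    [q]. *)
Lemma infix_blockE {w} : uniq w -> infix (filter in_block w) w ->
  exists p q, w = p ++ filter in_block w ++ q /\ all (predC in_block) (p ++ q).
Proof.
move=> uw /infixP[p [q e]]; exists p, q; split => //.
have := congr1 (filter in_block) e; rewrite !filter_cat filter_id => e'.
have := congr1 size e'; rewrite !size_cat addnCA -[LHS]addn0 => /addnI/esym/eqP.
by rewrite addn_eq0 !size_eq0 all_cat !all_predC !has_filter !negbK.
Qed.

Lemma all_in_block v : perm_eq v (iota k l) -> all in_block v.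
Proof. by move=> pv; apply/allP => x; rewrite (perm_mem pv) mem_iota. Qed.

Hypothesis l_gt0 : 0 < l.

Definition inflate (w : seq nat) : seq nat :=
  flatten [seq if x == k then iota k l else [:: if x < k then x else x + l.-1] | x <- w].

(** The smallest block value [k] survives as the representative of the block, which is the letter
    that [inflate] expands. *)
Definition deflate (w : seq nat) : seq nat :=
  [seq if x <= k then x else x - l.-1 | x <- w & ~~ (k < x < k + l)].

Lemma inflate_cat u v : inflate (u ++ v) = inflate u ++ inflate v.
Proof. by rewrite /inflate map_cat flatten_cat. Qed.

Lemma deflate_cat u v : deflate (u ++ v) = deflate u ++ deflate v.
Proof. by rewrite /deflate filter_cat map_cat. Qed.

Lemma deflate_block : deflate (iota k l) = [:: k].
Proof.
rewrite /deflate -(prednK l_gt0) /= ltnn /=.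
rewrite (@eq_in_filter _ _ pred0) ?filter_pred0 /= ?leqnn // => x.
by rewrite mem_iota /=; lia.
Qed.

Lemma inflateK : cancel inflate deflate.
Proof.
elim=> //= x w IH; rewrite -cat1s inflate_cat deflate_cat IH; congr cat.
rewrite /inflate /= cats0; case: eqP => [->|hx]; first exact: deflate_block.
rewrite /deflate /=; case: (ltnP x k) => hk.
  by rewrite ifT /= ?(ltnW hk) //; lia.
rewrite ifT /=; last by lia.
by rewrite ifF; [congr [:: _]; lia|lia].
Qed.

Lemma inflate_map w : k \notin w ->
  inflate w = [seq if x < k then x else x + l.-1 | x <- w].
Proof.
elim: w => //= x w IH; rewrite inE negb_or => /andP[xk kw].
by rewrite -cat1s inflate_cat IH // /inflate /= eq_sym (negbTE xk).
Qed.

Lemma inflate_block : inflate [:: k] = iota k l.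
Proof. by rewrite /inflate /= eqxx cats0. Qed.

Lemma deflateK w : all (predC in_block) w -> inflate (deflate w) = w.
Proof.
elim: w => //= x w IH /andP[hx hw].
rewrite -cat1s deflate_cat inflate_cat IH //; congr cat.
rewrite /deflate /= ifT; last by move: hx; rewrite /in_block; lia.
move: hx; rewrite /in_block /inflate /=.
case: (leqP x k) => h1 h2; rewrite cats0.
  by rewrite ifF; [rewrite ifT //; lia|lia].
by rewrite ifF; [rewrite ifF; [congr [:: _]; lia|lia]|lia].
Qed.

(** With [perm_inflate] and [perm_deflate], this check on the sorted word shows that both maps carry
    permutations to permutations. *)
Lemma inflate_iota m : inflate (iota 0 (k + m.+1)) = iota 0 (k + l + m).
Proof.
have -> : k + m.+1 = k + 1 + m by lia.
rewrite !iotaD !inflate_cat /= inflate_block !add0n; congr ((_ ++ _) ++ _).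
  rewrite inflate_map ?mem_iota; last by lia.
  by rewrite -[RHS]map_id; apply/eq_in_map => x; rewrite mem_iota => hx; rewrite ifT //; lia.
rewrite inflate_map ?mem_iota; last by lia.
have -> : k + l = l.-1 + (k + 1) by lia.
rewrite [RHS]iotaDl; apply/eq_in_map => x; rewrite mem_iota => hx.
by rewrite ifF; lia.
Qed.

Lemma perm_inflate {u v} : perm_eq u v -> perm_eq (inflate u) (inflate v).
Proof. by move=> h; apply/perm_flatten/perm_map. Qed.

Lemma perm_deflate {u v} : perm_eq u v -> perm_eq (deflate u) (deflate v).
Proof. by move=> h; apply/perm_map/perm_filter. Qed.

Lemma av_inflate u t : k \notin u ++ t ->
  av (inflate (u ++ k :: t)) = av (u ++ k :: t).
Proof.
rewrite mem_cat negb_or => /andP[ku kt].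
set f := fun x => if x < k then x else x + l.-1.
have fmono : {mono f : x y / x < y}.
  by move=> x y; rewrite /f; case: (ltnP x k); case: (ltnP y k); lia.
have avf w : av (map f w) = av w.
  elim: w => //= x w ->; rewrite pairwise_map; congr andb.
  by apply: eq_pairwise => y z /=; rewrite !fmono.
rewrite -cat1s !inflate_cat inflate_block !inflate_map //.
(* The representative is the top block value [f k = k + l.-1], so the contracted word is the image
   of the original under the strictly increasing [f]. *)
rewrite (@av_collapse _ _ _ _ (f k)); last 2 first.
- by rewrite /f ltnn; lia.
- rewrite -map_cat all_map; apply/allP => x; rewrite mem_cat => hx /=.
  have : x != k by case/orP: hx => hx; apply: contraTneq hx => ->.
  by rewrite /f; case: ltnP; lia.
by rewrite -map_cons -map_cat avf.
Qed.

Lemma count_increasing_block m : 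
  count (fun w => [&& av w, infix (filter in_block w) w & filter in_block w == iota k l])
    (permutations (iota 0 (k + l + m))) = size (av_words (k + m.+1)).
Proof.
rewrite -(size_map inflate (av_words _)); apply: count_permutations.
  by rewrite map_inj_uniq ?uniq_av_words //; apply: can_inj inflateK.
move=> w; apply/mapP/and4P => [[v]|[pw aw iw /eqP ew]].
  rewrite mem_av_words => /andP[pv av_v] ->.
  have hk : k \in v by rewrite (perm_mem pv) mem_iota; lia.
  have uv : uniq v by rewrite (perm_uniq pv) iota_uniq.
  have := perm_inflate pv; rewrite inflate_iota => pi.
  case/splitPr: hk pv av_v uv pi => u t pv av_v uv pi.
  have kn : k \notin u ++ t.
    by move: uv; rewrite -cat1s uniq_catCA /= => /andP[].
  rewrite av_inflate //.
  have e : filter in_block (inflate (u ++ k :: t)) = iota k l.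
    rewrite -cat1s !inflate_cat inflate_block.
    move: kn; rewrite mem_cat negb_or => /andP[ku kt].
    apply: filter_in_block_cat; first exact: all_in_block.
    rewrite !inflate_map // -map_cat all_map; apply/allP => x; rewrite mem_cat => hx /=.
    have : x != k by case/orP: hx => hx; apply: contraTneq hx => ->.
    by rewrite /in_block; case: ltnP; lia.
  split=> //; last by rewrite e.
  rewrite e -cat1s !inflate_cat inflate_block.
  by apply/infixP; exists (inflate u), (inflate t).
have uw : uniq w by rewrite (perm_uniq pw) iota_uniq.
have [p [q []]] := infix_blockE uw iw; rewrite ew => e hpq.
have [hp hq] : all (predC in_block) p /\ all (predC in_block) q.
  by apply/andP; rewrite -all_cat.
(* The block of [w] is the increasing run, which is exactly what [inflate] restores from the letter
   [k]. *)
have eK : inflate (deflate w) = w.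
  by rewrite e !deflate_cat deflate_block !inflate_cat inflate_block !deflateK.
have pd : perm_eq (deflate w) (iota 0 (k + m.+1)).
  by rewrite -(inflateK (iota 0 _)) inflate_iota perm_deflate.
exists (deflate w) => //; rewrite mem_av_words pd /=.
have : uniq (deflate w) by rewrite (perm_uniq pd) iota_uniq.
move: aw; rewrite -{1}eK e !deflate_cat deflate_block /= => aw.
rewrite -cat1s uniq_catCA /= => /andP[kn _].
by rewrite -av_inflate.
Qed.

Lemma count_decreasing_block m :
  count (fun w => [&& av w, infix (filter in_block w) w & filter in_block w != iota k l])
    (permutations (iota 0 (k + l + m))) =
  size (av_words k) * (size (av_words m) * (size (av_words l) - 1)).
Proof.
(* The three summands, with values below, in and above the block. Removing the increasing word from
   [V] accounts for the [- 1]. *)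
pose U := av_words k.
pose V := rem (iota k l) [seq map (addn k) u | u <- av_words l].
pose T := [seq map (addn (k + l)) u | u <- av_words m].
have memU u : (u \in U) = perm_eq u (iota 0 k) && av u by exact: mem_av_words.
have memT t : (t \in T) = perm_eq t (iota (k + l) m) && av t by exact: mem_shift_av_words.
have inj_addn j : injective (map (addn j)) by apply/inj_map/addnI.
have uV' : uniq [seq map (addn k) u | u <- av_words l].
  by rewrite map_inj_uniq // uniq_av_words.
have memV v : (v \in V) = [&& v != iota k l, perm_eq v (iota k l) & av v].
  by rewrite mem_rem_uniq // !inE mem_shift_av_words.
have mem_iotaV : iota k l \in [seq map (addn k) u | u <- av_words l].
  by rewrite mem_shift_av_words perm_refl av_iota.
have -> : size (av_words l) - 1 = size V by rewrite size_rem // size_map subn1.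
have -> : size (av_words m) = size T by rewrite size_map.
rewrite (mulnC (size T)) -/U -!(size_allpairs cat); apply: count_permutations.
  have uVT : uniq [seq v ++ t | v <- V, t <- T].
    apply: allpairs_uniq.
    - exact: rem_uniq.
    - by rewrite map_inj_uniq ?uniq_av_words.
    move=> _ _ /allpairsP[[v t] [+ _ ->]] /allpairsP[[v' t'] [+ _ ->]] /=.
    rewrite !memV => /and3P[_ /perm_size pv _] /and3P[_ /perm_size pv' _] /eqP.
    by rewrite eqseq_cat ?pv' // => /andP[/eqP-> /eqP->].
  apply: allpairs_uniq => //; first exact: uniq_av_words.
  move=> _ _ /allpairsP[[u z] [+ _ ->]] /allpairsP[[u' z'] [+ _ ->]] /=.
  rewrite !memU => /andP[/perm_size pu _] /andP[/perm_size pu' _] /eqP.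
  by rewrite eqseq_cat ?pu' // => /andP[/eqP-> /eqP->].
move=> w; apply/allpairsP/and4P => [[[u z] [/= + /allpairsP[[v t] [/= + + ->]] ->]]|].
  rewrite memU memV memT => /andP[pu au] /and3P[nv pv avv] /andP[pt at_].
  have e : filter in_block (u ++ v ++ t) = v.
    apply: filter_in_block_cat; first exact: all_in_block.
    apply/allP => x; rewrite mem_cat (perm_mem pu) (perm_mem pt) !mem_iota.
    by rewrite /= /in_block; lia.
  rewrite e; split=> //.
  - by rewrite -addnA !iotaD !perm_cat.
  - rewrite !av_direct_sum ?au ?avv //; apply/allrelP => x y.
      by rewrite (perm_mem pv) (perm_mem pt) !mem_iota; lia.
    by rewrite mem_cat (perm_mem pu) (perm_mem pv) (perm_mem pt) !mem_iota; lia.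
  - by apply/infixP; exists u, t.
case=> pw aw iw nw.
have uw : uniq w by rewrite (perm_uniq pw) iota_uniq.
have pv := filter_in_block_perm _ _ (leq_addr m (k + l)) pw.
have [p [q [e hpq]]] := infix_blockE uw iw.
set v := filter in_block w in pv nw e.
(* The only increasing arrangement of the block is [iota k l], so [v] has an inversion. *)
have nv : ~~ pairwise leq v.
  apply: contra nw => hv; apply/eqP; apply: (pairwise_eq anti_leq) => //.
  by rewrite -(sorted_pairwise leq_trans) iota_sorted.
have [ap av_q] : av (p ++ v) /\ av (v ++ q).
  by move: aw; rewrite e => aw; split; [move: aw; rewrite catA => /av_catl|exact: av_catr aw].
(* An entry of [p] not below [k] would exceed the whole block and force [v] to be increasing; [ge_q]
   is the mirror argument. *)
have lt_p x : x \in p -> x < k.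
  move=> xp; have : ~~ in_block x by apply: (allP hpq); rewrite mem_cat xp.
  rewrite /in_block; case: (ltnP x k) => //= kx; rewrite -leqNgt => lx.
  case/negP: nv; apply: (av_above_left _ _ _ ap xp); apply/allP => y.
  by rewrite (perm_mem pv) mem_iota => /andP[_ yl]; exact: leq_trans yl lx.
have ge_q x : x \in q -> k + l <= x.
  move=> xq; have : ~~ in_block x by apply: (allP hpq); rewrite mem_cat xq orbT.
  rewrite /in_block; case: (ltnP x (k + l)) => //= kx; rewrite andbT -ltnNge => lx.
  case/negP: nv; apply: (av_below_right _ _ _ av_q xq); apply/allP => y.
  by rewrite (perm_mem pv) mem_iota => /andP[ky _]; exact: leq_trans lx ky.
(* Since [w] exhausts the values below [k + l + m], the bounds on [p] and [q] determine their sets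
   of entries. *)
have memw x : (x < k + l + m) = [|| x \in p, k <= x < k + l | x \in q].
  by have := perm_mem pw x; rewrite e !mem_cat (perm_mem pv) !mem_iota /= => ->.
move: uw; rewrite e !cat_uniq => /and5P[up _ _ _ uq].
have pp : perm_eq p (iota 0 k).
  apply: uniq_perm; rewrite ?iota_uniq // => x; rewrite mem_iota /=.
  apply/idP/idP => [/lt_p //|xk].
  have := memw x; rewrite -addnA ltn_addr // => /esym/or3P[//|/andP[kx _]|/ge_q xq].
    by rewrite ltnNge kx in xk.
  by have := leq_trans xk (leq_trans (leq_addr l k) xq); rewrite ltnn.
have pq : perm_eq q (iota (k + l) m).
  apply: uniq_perm; rewrite ?iota_uniq // => x; rewrite mem_iota /=.
  apply/idP/idP => [xq|/andP[kx xm]].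
    by rewrite ge_q //= memw xq !orbT.
  have := memw x; rewrite xm => /esym/or3P[/lt_p xk|/andP[_ xl]|//].
    by have := leq_trans xk (leq_trans (leq_addr l k) kx); rewrite ltnn.
  by rewrite ltnNge kx in xl.
exists (p, v ++ q); split => //=; first by rewrite memU pp (av_catl _ _ ap).
apply/allpairsP; exists (v, q); split => //=; first by rewrite memV nw pv (av_catr _ _ ap).
by rewrite memT pq (av_catr _ _ av_q).
Qed.

End Block.

(** * Permutations as words *)

Definition word {n} (s : 'S_n) : seq nat := [seq val (s i) | i : 'I_n].

Lemma size_word {n} (s : 'S_n) : size (word s) = n.
Proof. by rewrite size_map size_enum_ord. Qed.

Lemma nth_word {n} (s : 'S_n) (i : 'I_n) : nth 0 (word s) i = s i.
Proof. by rewrite (nth_map i) ?size_enum_ord // nth_ord_enum. Qed.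

Lemma word_inj n : injective (@word n).
Proof. by move=> s t e; apply/permP => i; apply: val_inj; rewrite /= -!nth_word e. Qed.

Lemma perm_word {n} (s : 'S_n) : perm_eq (word s) (iota 0 n).
Proof.
apply: uniq_perm; rewrite ?iota_uniq //.
  by rewrite map_inj_uniq ?enum_uniq // => i j /val_inj/perm_inj.
move=> x; rewrite mem_iota /=; apply/mapP/idP => [[i _ ->]|hx]; first exact: ltn_ord.
by exists ((s^-1)%g (Ordinal hx)); rewrite ?mem_enum // permKV.
Qed.

Lemma word_surj {n w} : perm_eq w (iota 0 n) -> exists s : 'S_n, word s = w.
Proof.
move=> pw; have sw := perm_iota_size pw.
have uw : uniq w by rewrite (perm_uniq pw) iota_uniq.
(* The default [i] of [insubd] never occurs, as every entry of [w] is below [n]. *)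
pose f (i : 'I_n) : 'I_n := insubd i (nth 0 w i).
have fE i : val (f i) = nth 0 w i.
  by rewrite insubdK // unfold_in; apply: (allP (perm_iota_lt pw)); rewrite mem_nth ?sw.
have f_inj : injective f.
  move=> i j /(congr1 val); rewrite !fE => /eqP.
  by rewrite nth_uniq ?sw // => /eqP/val_inj.
exists (perm f_inj); apply: (@eq_from_nth _ 0) => [|i]; rewrite size_word ?sw // => hi.
by rewrite (nth_word _ (Ordinal hi)) permE fE.
Qed.

Lemma card_word n (P : pred (seq nat)) :
  #|[set s : 'S_n | P (word s)]| = count P (permutations (iota 0 n)).
Proof.
rewrite (@count_permutations _ _ [seq word s | s in [set s : 'S_n | P (word s)]]).
- by rewrite size_map -cardE.
- by rewrite map_inj_uniq ?enum_uniq //; exact: word_inj.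
move=> w; apply/imageP/andP => [[s]|[/word_surj[s <-] Ps]].
  by rewrite inE => Ps ->; rewrite perm_word.
by exists s; rewrite ?inE.
Qed.

(** Reversal is a bijection on the rearrangements of [iota 0 n]; this transfers the count for 123 to
    that for 321. *)
Lemma card_word_rev n (P : pred (seq nat)) :
  #|[set s : 'S_n | P (rev (word s))]| = count P (permutations (iota 0 n)).
Proof.
rewrite (card_word n (fun w => P (rev w))) -(count_map rev P); apply/seq.permP.
apply: uniq_perm; rewrite ?permutations_uniq //.
  by rewrite map_inj_uniq ?permutations_uniq //; exact: (can_inj revK).
have permrev (w : seq nat) : perm_eq (rev w) w by rewrite perm_rev.
move=> w; rewrite -{1}(revK w) mem_map; last exact: (can_inj revK).
by rewrite !mem_permutations (permPl (permrev w)).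
Qed.

(** * Pattern containment expressed through [av] *)

Lemma avP (w : seq nat) :
  reflect (forall a b c, a < b < c -> c < size w -> ~~ (nth 0 w c < nth 0 w b < nth 0 w a))
    (av w).
Proof.
elim: w => [|x w IH] /=; first by constructor => a b c _.
apply: (iffP andP) => [[/(pairwiseP 0) hx /IH hw]|H].
  case=> [|a] [|b] [|c] // abc hc; try by exfalso; lia.
    by apply: hx; rewrite ?inE; lia.
  exact: hw.
split; last by apply/IH => a b c abc hc; exact: (H a.+1 b.+1 c.+1).
by apply/(pairwiseP 0) => b c _; rewrite inE => hc bc; exact: (H 0 b.+1 c.+1).
Qed.

Lemma av_revP (w : seq nat) :
  reflect (forall a b c, a < b < c -> c < size w -> ~~ (nth 0 w a < nth 0 w b < nth 0 w c))
    (av (rev w)).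
Proof.
apply: (iffP (avP _)) => H a b c abc; rewrite ?size_rev => hc; last first.
  by rewrite !nth_rev; try lia; apply: H; lia.
(* Reversal sends position [i] to [size w - i.+1], so the triple is read backwards. *)
have := H (size w - c.+1) (size w - b.+1) (size w - a.+1).
rewrite size_rev !nth_rev; try lia.
have sub i : i < size w -> size w - (size w - i.+1).+1 = i by lia.
by rewrite !sub; try lia; apply; lia.
Qed.

Lemma nth_one_line n (s : 'S_n) (j : 'I_n) : nth 0 (one_line s) j = (s j).+1.
Proof. by rewrite (nth_map j) ?size_enum_ord // nth_ord_enum. Qed.

(** A list of three positions replaces the finite function, so that an occurrence can be
    destructured or written out explicitly. *)
Lemma contains_pattern3P {n} (t : 'S_3) (s : 'S_n) :
  reflect (exists i : seq 'I_n, exists i0,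
      [/\ size i = 3, sorted ltn (map val i) &
        forall j j' : 'I_3, (s (nth i0 i j) < s (nth i0 i j')) =
          (nth 0 (one_line t) j < nth 0 (one_line t) j')])
    (contains_pattern t s).
Proof.
apply: (iffP existsP) => [[f /andP[/forallP hf /forallP ht]]|[i [i0 [si oi ti]]]].
  exists (map f (enum 'I_3)), (f ord0); split.
  - by rewrite size_map size_enum_ord.
  - rewrite !enum_ordSl enum_ord0 /= andbT; apply/andP; split.
      by have /forallP/(_ (lift ord0 ord0))/implyP := hf ord0; apply.
    have /forallP/(_ (lift ord0 (lift ord0 ord0)))/implyP := hf (lift ord0 ord0).
    by apply.
  have nth_f (j : 'I_3) : nth (f ord0) (map f (enum 'I_3)) j = f j.
    by rewrite (nth_map ord0) ?nth_ord_enum // size_enum_ord.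
  move=> j j'; rewrite !nth_one_line !nth_f.
  by have /forallP/(_ j')/eqP -> := ht j.
exists [ffun j : 'I_3 => nth i0 i j]; apply/andP; split; apply/forallP => j; apply/forallP => j'.
  apply/implyP => jj'; rewrite !ffunE -!(nth_map i0 0) ?si //.
  by apply: (sorted_ltn_nth ltn_trans) => //; rewrite inE size_map si.
by rewrite !ffunE ti !nth_one_line.
Qed.

Lemma contains_321 n (t : 'S_3) (s : 'S_n) : one_line t = [:: 3; 2; 1] ->
  contains_pattern t s = ~~ av (word s).
Proof.
move=> et; apply/idP/idP => [/contains_pattern3P[i [i0 [si oi ti]]]|].
  apply/negP => /avP; case: i si oi ti => [|a [|b [|c []]]] //= _ /and3P[ab bc _] ti.
  move=> /(_ a b c); rewrite ab bc size_word ltn_ord !nth_word.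
  have := ti (inord 2) (inord 1); have := ti (inord 1) (inord 0).
  by rewrite !inordK // et /= => -> -> /(_ isT isT).
apply: contraR => nc; apply/avP => a b c /andP[ab bc]; rewrite size_word => cn.
have bn := ltn_trans bc cn; have an := ltn_trans ab bn.
rewrite !(nth_word s (Ordinal an), nth_word s (Ordinal bn), nth_word s (Ordinal cn)).
apply: contra nc => /andP[cb ba]; apply/contains_pattern3P.
exists [:: Ordinal an; Ordinal bn; Ordinal cn], (Ordinal an).
rewrite /= ab bc; split=> //; rewrite et.
by case=> [[|[|[|//]]] ?] [[|[|[|//]]] ?] /=; lia.
Qed.

Lemma contains_123 n (t : 'S_3) (s : 'S_n) : one_line t = [:: 1; 2; 3] ->
  contains_pattern t s = ~~ av (rev (word s)).
Proof.
move=> et; apply/idP/idP => [/contains_pattern3P[i [i0 [si oi ti]]]|].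
  apply/negP => /av_revP; case: i si oi ti => [|a [|b [|c []]]] //= _ /and3P[ab bc _] ti.
  move=> /(_ a b c); rewrite ab bc size_word ltn_ord !nth_word.
  have := ti (inord 0) (inord 1); have := ti (inord 1) (inord 2).
  by rewrite !inordK // et /= => -> -> /(_ isT isT).
apply: contraR => nc; apply/av_revP => a b c /andP[ab bc]; rewrite size_word => cn.
have bn := ltn_trans bc cn; have an := ltn_trans ab bn.
rewrite !(nth_word s (Ordinal an), nth_word s (Ordinal bn), nth_word s (Ordinal cn)).
apply: contra nc => /andP[cb ba]; apply/contains_pattern3P.
exists [:: Ordinal an; Ordinal bn; Ordinal cn], (Ordinal an).
rewrite /= ab bc; split=> //; rewrite et.
by case=> [[|[|[|//]]] ?] [[|[|[|//]]] ?] /=; lia.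
Qed.

(** * Clustered permutations and their count *)

Definition has_block k l (w : seq nat) := infix (filter (in_block k l) w) w.

Lemma clusteredE {n l k} (s : 'S_n) : 0 < l -> k + l <= n ->
  (s \in clustered n l k.+1) = has_block k l (word s).
Proof.
move=> l0 hkl; rewrite inE; have sw := size_word s.
have -> : [set j : 'I_n | k < j.+1 <= k.+1 + l - 1] = [set j : 'I_n | in_block k l j].
  by apply/setP => j; rewrite !inE /in_block; lia.
(* Injectivity of [s] turns the equality of sets into a condition checked position by position. *)
have imE a : ([set j : 'I_n | in_block k l j] == [set s i | i : 'I_n & a <= i < a + l]) =
    [forall i : 'I_n, in_block k l (s i) == (a <= i < a + l)].
  apply/eqP/'forall_eqP => [/setP e i|H].
    by have := e (s i); rewrite (mem_imset _ _ perm_inj) !inE.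
  apply/setP => j; rewrite -(permKV s j) (mem_imset _ _ perm_inj) !inE; exact: H.
apply/existsP/idP => [[a /andP[an]]|hb].
  rewrite imE => /'forall_eqP H.
  have ew : word s = take a (word s) ++ take l (drop a (word s)) ++ drop (a + l) (word s).
    by rewrite addnC -drop_drop !cat_take_drop.
  have nthB i : i < n -> in_block k l (nth 0 (word s) i) = (a <= i < a + l).
    by move=> hi; rewrite (nth_word s (Ordinal hi)) H.
  have e : filter (in_block k l) (word s) = take l (drop a (word s)).
    rewrite {1}ew; apply: filter_in_block_cat.
      have szl : size (take l (drop a (word s))) = l by rewrite size_takel // size_drop size_word; lia.
      apply/(all_nthP 0) => i; rewrite szl => hi.
      by rewrite nth_take // nth_drop nthB; lia.
    rewrite all_cat; apply/andP; split; apply/(all_nthP 0) => i.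
      have -> : size (take a (word s)) = a by rewrite size_takel // size_word; lia.
      by move=> hi; rewrite /= nth_take // nthB; lia.
    by rewrite size_drop size_word => hi; rewrite /= nth_drop nthB; lia.
  by rewrite /has_block e; apply/infixP; exists (take a (word s)), (drop (a + l) (word s)).
have pw := perm_word s.
have uw : uniq (word s) by rewrite (perm_uniq pw) iota_uniq.
have pv := filter_in_block_perm _ _ _ _ hkl pw.
have := perm_size pv; rewrite size_iota.
have := all_in_block _ _ _ pv.
have [p [q []]] := infix_blockE _ _ uw hb.
set v := filter _ _ => e; rewrite all_cat => /andP[hp hq] hv sv.
have sn : n = size p + (l + size q) by rewrite -sw e !size_cat sv.
have pn : size p < n by lia.
(* The block starts right after the prefix [p]; [0 < l] makes this a valid position. *)
exists (Ordinal pn) => /=; rewrite imE; apply/andP; split; first by lia.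
apply/'forall_eqP => i; rewrite -nth_word e !nth_cat sv.
have hi := ltn_ord i.
case: (ltnP i (size p)) => ip.
  by have /= /negbTE-> := all_nthP 0 hp i ip; lia.
case: (ltnP (i - size p) l) => il.
  by have /= -> := all_nthP 0 hv (i - size p); rewrite ?sv //; lia.
have iq : i - size p - l < size q by lia.
by have /= /negbTE-> := all_nthP 0 hq _ iq; lia.
Qed.

Lemma has_block_rev k l w : has_block k l (rev w) = has_block k l w.
Proof. by rewrite /has_block filter_rev infix_rev. Qed.

Lemma count_av n : count av (permutations (iota 0 n)) = size (av_words n).
Proof. by apply: count_permutations (uniq_av_words n) (mem_av_words n). Qed.

Lemma count_block k l m : 0 < l ->
  count (fun w => has_block k l w && av w) (permutations (iota 0 (k + l + m))) =
  size (av_words (k + m.+1)) +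
  size (av_words k) * (size (av_words m) * (size (av_words l) - 1)).
Proof.
move=> l0; rewrite -(count_increasing_block k l l0) -(count_decreasing_block k l l0).
(* The increasing and non-increasing cases are disjoint, so the intersection term is zero. *)
rewrite -count_predUI -[LHS]addn0; congr addn; last first.
  rewrite (@eq_count _ _ pred0) ?count_pred0 // => w /=.
  by case: (_ == iota k l); rewrite ?andbF.
apply: eq_count => w /=; rewrite -/(has_block k l w).
by case: (_ == iota k l); rewrite ?andbF ?andbT ?orbF andbC.
Qed.

(** Invariance of [P] under reversal lets both patterns share one count. *)
Lemma card_avoiders n (t : 'S_3) (A : {set 'S_n}) (P : pred (seq nat)) :
  one_line t = [:: 1; 2; 3] \/ one_line t = [:: 3; 2; 1] ->
  (forall s, (s \in A) = P (word s)) -> (forall w, P (rev w) = P w) ->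
  #|A :&: avoiders n t| = count (fun w => P w && av w) (permutations (iota 0 n)).
Proof.
move=> ht hA hP; case: ht => ht; [rewrite -card_word_rev|rewrite -card_word];
  apply: eq_card => s; rewrite !inE hA ?hP.
  by rewrite contains_123 // negbK.
by rewrite contains_321 // negbK.
Qed.

(** * Catalan numbers and the final formula *)

Local Open Scope ring_scope.

Lemma catalanE n : catalan n = (size (av_words n))%:R.
Proof.
rewrite size_av_words /catalan.
(* The ballot formula at [s = 0], with adjacent binomials related by [mul_bin_left]. *)
have : ('C(2 * n, n) = n.+1 * descendants n 0)%N.
  have := descendantsE n 0; rewrite addn0; case: n => [|n] // H.
  have := mul_bin_left (2 * n.+1) n.
  have -> : (2 * n.+1 - n = n.+2)%N by lia.
  by nia.
by move=> ->; rewrite natrM mulrA mulVf ?mul1r // Num.Theory.pnatr_eq0.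
Qed.

Theorem theorem3 (tau : 'S_3) (n l k : nat)
    (htau : one_line tau = [:: 1; 2; 3]%N \/ one_line tau = [:: 3; 2; 1]%N)
    (hn : (3 <= n)%N) (hl : (2 <= l <= n - 1)%N)
    (hk : (1 <= k)%N) (hkl : (k + l - 1 <= n)%N) :
  avoid_prob tau (clustered n l k) =
  (catalan (n - l + 1)
     + catalan (k - 1) * catalan (n + 1 - k - l) * (catalan l - 1))
  / catalan n.
Proof.
case: k hk hkl => // k _ hkl.
have l0 : (0 < l)%N by lia.
have hkln : (k + l <= n)%N by lia.
(* Here [m] counts the values above the block. *)
have [m en] : exists m, n = (k + l + m)%N by exists (n - (k + l))%N; lia.
rewrite /avoid_prob (card_avoiders n tau _ (has_block k l)) //; last 2 first.
- by move=> s; exact: clusteredE.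
- exact: has_block_rev.
(* The denominator is the same count with the trivial predicate. *)
rewrite -[avoiders n tau]setTI (card_avoiders n tau _ predT) //; last first.
  by move=> s; rewrite inE.
have -> : count (fun w => predT w && av w) (permutations (iota 0 n)) = size (av_words n).
  by rewrite -count_av; exact: eq_count.
rewrite {1}en count_block // !catalanE.
have -> : (n - l + 1 = k + m.+1)%N by lia.
have -> : (k.+1 - 1 = k)%N by lia.
have -> : (n + 1 - k.+1 - l = m)%N by lia.
(* There is at least one avoider of size [l], so the natural-number subtraction of 1 agrees with the
   rational one. *)
have pos : (0 < size (av_words l))%N.
  by rewrite -has_predT; apply/hasP; exists (iota 0 l); rewrite ?mem_av_words ?perm_refl ?av_iota.
by rewrite natrD !natrM natrB // mulrA.
Qed.
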